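(* Let $\Delta:\mathbb B\to\mathbb B\times\mathbb B$ be the diagonal, $Q:=\mathrm{Coker}(\mathfrak s\Delta)$, $\mathrm{cok}(\mathfrak s\Delta):\mathbb B^2\times\mathbb B^2\to Q$ the cokernel map, $K:=\mathrm{Ker}(\mathrm{cok}(\mathfrak s\Delta))$ and $F:=\underline{\mathrm{Hom}}_{\mathrm{Bmod}^{\mathfrak s}}(Q,-)$. The short doubly exact sequence $$\alpha:\ K\xrightarrow{\ \subset\ }\mathbb B^2\times\mathbb B^2\xrightarrow{\ \mathrm{cok}(\mathfrak s\Delta)\ }Q$$ satisfies condition (a) with respect to the functor $F$: for every short doubly exact sequence $c:C'\xrightarrow{c'}C\xrightarrow{c''}C''$ in $\mathrm{Bmod}^{\mathfrak s}$, every morphism $v:C'\to K$ and any two morphisms of short doubly exact sequences $w_1,w_2:c\to\alpha$ both inducing $v$, one has $F(w_1'')=F(w_2''):\mathrm{Coker}(F(c''))\to\mathrm{Coker}(F(\mathrm{cok}(\mathfrak s\Delta)))$. Moreover the right satellite functor $SF$ is non-null (it takes a non-null value), and $SF(K)=\mathrm{Coker}\big(F(\mathrm{cok}(\mathfrak s\Delta))\big)$.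
   Context: $\mathbb B=\{0,1\}$ is the Boolean semifield ($1+1=1$). A $\mathbb B$-module is a commutative monoid $(M,+,0)$ with $x+x=x$ for all $x$; morphisms are the monoid homomorphisms. $\mathrm{Bmod}^{\mathfrak s}$ is the category of $\mathbb B$-modules endowed with an involution $\sigma$ (an endomorphism with $\sigma^2=\mathrm{id}$), with morphisms the $\mathbb B$-module morphisms commuting with $\sigma$. $M^\sigma$ is the set of fixed points of $\sigma$; an object is null if $\sigma=\mathrm{id}$. For a $\mathbb B$-module $M$, $\mathfrak sM:=M\times M$ with involution $(x,y)\mapsto(y,x)$; for $f:M\to N$, $\mathfrak sf(x,y)=(f(x),f(y))$. Thus $\mathfrak s\Delta:\mathfrak s\mathbb B\to\mathfrak s(\mathbb B^2)=\mathbb B^2\times\mathbb B^2$. For $h:L\to M$, $\mathrm{Ker}(h):=h^{-1}(M^\sigma)$ (with its inclusion in $L$), and $\mathrm{Coker}(h):=M/\!\sim$ (with the quotient map $\mathrm{cok}(h)$), where $b\sim b'$ iff $g(b)=g(b')$ for every object $X$ and every morphism $g:M\to X$ of $\mathrm{Bmod}^{\mathfrak s}$ with $\mathrm{Range}(h)\subset\mathrm{Ker}(g)$. A short doubly exact sequence is a pair $L\xrightarrow{m}M\xrightarrow{q}N$ with $m$ the kernel of $q$ and $q$ the cokernel of $m$. Morphisms $w:c\to d$ of such sequences are triples $(w',w,w'')$ of morphisms commuting with the structure maps; $w$ induces $v$ if $w'=v$. $\underline{\mathrm{Hom}}_{\mathrm{Bmod}^{\mathfrak s}}(L,M)$ is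 the $\mathbb B$-module of morphisms with pointwise addition and involution $f\mapsto\sigma\circ f=f\circ\sigma$. For a morphism $w:c\to d$, $F(w''):F(C'')\to F(D'')$ descends to $\mathrm{Coker}(F(c''))\to\mathrm{Coker}(F(d''))$, still denoted $F(w'')$. Right satellite. Fix a small full subcategory $\mathrm{Sh}_{\mathrm{small}}$ of the category of short doubly exact sequences in $\mathrm{Bmod}^{\mathfrak s}$, containing (up to isomorphism) all short doubly exact sequences of finite objects. For an object $X$, let $\mathcal I_X$ be the comma category whose objects are pairs $(c,x)$ with $c=(C'\xrightarrow{c'}C\xrightarrow{c''}C'')$ in $\mathrm{Sh}_{\mathrm{small}}$ and $x:C'\to X$ a morphism, and whose morphisms $(c,x)\to(d,y)$ are the morphisms $w:c\to d$ with $y\circ w'=x$. Then $SF(X):=\varinjlim_{(c,x)\in\mathcal I_X}\mathrm{Coker}(F(c''))$, the colimit being taken in $\mathrm{Bmod}^{\mathfrak s}$; the equality for $SF(K)$ means that the canonical map from $\mathrm{Coker}(F(\mathrm{cok}(\mathfrak s\Delta)))$, the term indexed by $(\alpha,\mathrm{id}_K)$, to the colimit is an isomorphism. *)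

(* Defs.v *)
From HB Require Import structures.
From mathcomp Require Import all_boot ssralg.
From mathcomp Require Import boolp classical_sets cardinality.

Set Implicit Arguments.
Unset Strict Implicit.
Unset Printing Implicit Defensive.

Import GRing.Theory.
Local Open Scope ring_scope.

(* All the sets involved carry a choiceType structure; under the classical
   axioms of boolp every type has one, so that this is no restriction. *)

HB.mixin Record Nmodule_isIdempotent M of GRing.Nmodule M := {
  addrr_idem : forall x : M, x + x = x
}.

#[short(type="bmodType")]
HB.structure Definition Bmodule :=
  { M of Nmodule_isIdempotent M & GRing.Nmodule M }.

HB.mixin Record Bmodule_hasInvolution M of Bmodule M := {
  sig : M -> M;
  sig_nmod_morphism : nmod_morphism sig;
  sigK : involutive sig
}.

#[short(type="bmodsType")]
HB.structure Definition Bmods :=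
  { M of Bmodule_hasInvolution M & Bmodule M }.

HB.instance Definition _ (M : bmodsType) :=
  GRing.isNmodMorphism.Build M M sig sig_nmod_morphism.

HB.mixin Record isEquivariant (M N : bmodsType) (f : M -> N) := {
  bmods_sig : forall x, f (sig x) = sig (f x)
}.

HB.structure Definition BmodsMorphism (M N : bmodsType) :=
  { f of GRing.isNmodMorphism M N f & isEquivariant M N f }.

Notation "{ 'bmods' M -> N }" := (BmodsMorphism.type M%type N%type)
  (at level 0, M at level 98, N at level 99,
   format "{ 'bmods'  M  ->  N }") : type_scope.

Lemma bmods_ext (M N : bmodsType) (f g : {bmods M -> N}) : f =1 g -> f = g.
Proof.
case: f g => f [[f0] [fS]] [g [[g0] [gS]]] /= /funext fg.
case: g / fg g0 gS => g0 gS.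
have -> : f0 = g0.
  case: f0 g0 => [a b] [c d].
  by rewrite (Prop_irrelevance a c) (Prop_irrelevance b d).
by rewrite (Prop_irrelevance fS gS).
Qed.

HB.instance Definition _ (M : bmodsType) :=
  isEquivariant.Build M M (@sig M) (fun=> erefl).

Section Composition.
Variables (L M N : bmodsType) (g : {bmods M -> N}) (f : {bmods L -> M}).

Lemma comp_bmods_sig x : (g \o f) (sig x) = sig ((g \o f) x).
Proof. by rewrite /= !bmods_sig. Qed.
HB.instance Definition _ := isEquivariant.Build L N (g \o f) comp_bmods_sig.

Definition bcomp : {bmods L -> N} := g \o f.
End Composition.

Section Identity.
Variable M : bmodsType.
HB.instance Definition _ :=
  isEquivariant.Build M M (@idfun M) (fun=> erefl).
Definition bid : {bmods M -> M} := @idfun M.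
End Identity.

Definition is_iso (M N : bmodsType) (f : {bmods M -> N}) : Prop :=
  exists g : {bmods N -> M}, cancel f g /\ cancel g f.

Definition fixed (M : bmodsType) : {pred M} := [pred x | sig x == x].
Arguments fixed M : clear implicits.

Definition null (M : bmodsType) : Prop := forall x : M, sig x = x.

Section Kernel.
Variables (L M : bmodsType) (h : {bmods L -> M}).

Definition inKer : {pred L} := [pred x | h x \in fixed M].

Definition Ker : Type := {x : L | x \in inKer}.
HB.instance Definition _ := SubChoice.on Ker.

Lemma inKer_nmod_closed : GRing.nmod_closed inKer.
Proof.
split=> [|x y]; rewrite !inE; first by rewrite !raddf0.
by move=> /eqP hx /eqP hy; rewrite !raddfD /= hx hy.
Qed.
HB.instance Definition _ := GRing.SubChoice_isSubNmodule.Build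
  L _ Ker inKer_nmod_closed.

Lemma Ker_idem (x : Ker) : x + x = x.
Proof. by apply/val_inj; rewrite raddfD; exact: addrr_idem. Qed.
HB.instance Definition _ := Nmodule_isIdempotent.Build Ker Ker_idem.

Lemma inKer_sig x : x \in inKer -> sig x \in inKer.
Proof. by rewrite !inE bmods_sig => /eqP hx; rewrite !hx. Qed.
Definition Ker_sig (x : Ker) : Ker := Sub (sig (val x)) (inKer_sig (valP x)).

Lemma Ker_sig_nmod_morphism : nmod_morphism Ker_sig.
Proof.
by split=> [|x y]; apply/val_inj; rewrite ?SubK ?raddf0 //= raddfD.
Qed.
Lemma Ker_sigK : involutive Ker_sig.
Proof. by move=> x; apply/val_inj; rewrite !SubK sigK. Qed.
HB.instance Definition _ :=
  Bmodule_hasInvolution.Build Ker Ker_sig_nmod_morphism Ker_sigK.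

HB.instance Definition _ :=
  isEquivariant.Build Ker L (val : Ker -> L) (fun=> erefl).
Definition ker : {bmods Ker -> L} := (val : Ker -> L).
End Kernel.

Section Cokernel.
Local Open Scope quotient_scope.
Variables (L M : bmodsType) (h : {bmods L -> M}).

Definition kills (X : bmodsType) (g : {bmods M -> X}) : Prop :=
  forall l : L, h l \in inKer g.

Definition coker_rel : rel M := fun b b' =>
  `[< forall (X : bmodsType) (g : {bmods M -> X}), kills g -> g b = g b' >].

Lemma coker_rel_equiv : equiv_class_of coker_rel.
Proof.
split=> [x|x y|y x z].
- exact/asboolP.
- by apply/asboolP/asboolP => xy X g gh; rewrite (xy X g gh).
- move=> /asboolP xy /asboolP yz; apply/asboolP => X g gh.
  by rewrite (xy X g gh) (yz X g gh).
Qed.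
Canonical coker_equiv : equiv_rel M := EquivRelPack coker_rel_equiv.

Definition Coker : Type := {eq_quot coker_equiv}.
HB.instance Definition _ := Choice.on Coker.
HB.instance Definition _ := EqQuotient.on Coker.

Lemma coker_eqP b b' : reflect
  (forall (X : bmodsType) (g : {bmods M -> X}), kills g -> g b = g b')
  (\pi_Coker b == \pi_Coker b').
Proof. by rewrite piE; exact: asboolP. Qed.

Lemma coker_reprP (X : bmodsType) (g : {bmods M -> X}) (b : M) :
  kills g -> g (repr (\pi_Coker b)) = g b.
Proof. by apply/coker_eqP; rewrite reprK. Qed.

Definition Coker_add (x y : Coker) : Coker := \pi_Coker (repr x + repr y).
Definition Coker_zero : Coker := \pi_Coker 0.
Definition Coker_sig (x : Coker) : Coker := \pi_Coker (sig (repr x)).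

Lemma Coker_addE a b :
  Coker_add (\pi_Coker a) (\pi_Coker b) = \pi_Coker (a + b).
Proof. by apply/eqP/coker_eqP => X g gh; rewrite !raddfD /= !coker_reprP. Qed.

Lemma Coker_sigE a : Coker_sig (\pi_Coker a) = \pi_Coker (sig a).
Proof. by apply/eqP/coker_eqP => X g gh; rewrite !bmods_sig !coker_reprP. Qed.

Lemma Coker_addA : associative Coker_add.
Proof.
move=> x y z; elim/quotW: x => x; elim/quotW: y => y; elim/quotW: z => z.
rewrite (Coker_addE y z) (Coker_addE x y).
by rewrite (Coker_addE x (y + z)) (Coker_addE (x + y) z) addrA.
Qed.
Lemma Coker_addC : commutative Coker_add.
Proof.
move=> x y; elim/quotW: x => x; elim/quotW: y => y.
by rewrite (Coker_addE x y) (Coker_addE y x) addrC.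
Qed.
Lemma Coker_add0 : left_id Coker_zero Coker_add.
Proof. by move=> x; elim/quotW: x => x; rewrite [LHS]Coker_addE add0r. Qed.
HB.instance Definition _ :=
  GRing.isNmodule.Build Coker Coker_addA Coker_addC Coker_add0.

Lemma Coker_idem (x : Coker) : x + x = x.
Proof.
by elim/quotW: x => x; rewrite [LHS]Coker_addE addrr_idem.
Qed.
HB.instance Definition _ := Nmodule_isIdempotent.Build Coker Coker_idem.

Lemma Coker_sig_nmod_morphism : nmod_morphism Coker_sig.
Proof.
split=> [|x y]; first by rewrite Coker_sigE raddf0.
elim/quotW: x => x; elim/quotW: y => y.
by rewrite [X in Coker_sig X]Coker_addE !Coker_sigE [RHS]Coker_addE raddfD.
Qed.
Lemma Coker_sigK : involutive Coker_sig.
Proof.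
move=> x; elim/quotW: x => x.
by rewrite (Coker_sigE x) Coker_sigE sigK.
Qed.
HB.instance Definition _ :=
  Bmodule_hasInvolution.Build Coker Coker_sig_nmod_morphism Coker_sigK.

Definition cok_fun (b : M) : Coker := \pi_Coker b.
Lemma cok_nmod_morphism : nmod_morphism cok_fun.
Proof. by split=> [|x y] //; exact: (esym (Coker_addE x y)). Qed.
HB.instance Definition _ :=
  GRing.isNmodMorphism.Build M Coker cok_fun cok_nmod_morphism.
Lemma cok_fun_sig x : cok_fun (sig x) = sig (cok_fun x).
Proof. by exact: (esym (Coker_sigE x)). Qed.
HB.instance Definition _ := isEquivariant.Build M Coker cok_fun cok_fun_sig.
Definition cok : {bmods M -> Coker} := cok_fun.

Lemma cok_eqP b b' : cok b = cok b' <->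
  forall (X : bmodsType) (g : {bmods M -> X}), kills g -> g b = g b'.
Proof. by split=> [/eqP/coker_eqP|?]; last exact/eqP/coker_eqP. Qed.

Lemma cok_surj (x : Coker) : exists b, cok b = x.
Proof. by exists (repr x); exact: reprK. Qed.

Section Descent.
Variables (X : bmodsType) (g : {bmods M -> X}) (gh : kills g).

Definition coker_desc_fun (x : Coker) : X := g (repr x).
Lemma coker_desc_funE b : coker_desc_fun (cok b) = g b.
Proof. exact: coker_reprP. Qed.

Lemma coker_desc_nmod_morphism : nmod_morphism coker_desc_fun.
Proof.
split=> [|x y]; first by rewrite -(raddf0 cok) coker_desc_funE raddf0.
have [b <-] := cok_surj x; have [c <-] := cok_surj y.
by rewrite -raddfD !coker_desc_funE raddfD.
Qed.
HB.instance Definition _ :=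
  GRing.isNmodMorphism.Build Coker X coker_desc_fun coker_desc_nmod_morphism.
Lemma coker_desc_sig x : coker_desc_fun (sig x) = sig (coker_desc_fun x).
Proof.
by have [b <-] := cok_surj x; rewrite -bmods_sig !coker_desc_funE bmods_sig.
Qed.
HB.instance Definition _ :=
  isEquivariant.Build Coker X coker_desc_fun coker_desc_sig.
Definition coker_desc : {bmods Coker -> X} := coker_desc_fun.

Lemma coker_descE b : coker_desc (cok b) = g b.
Proof. exact: coker_desc_funE. Qed.
End Descent.

Lemma cok_kills : kills cok.
Proof.
move=> l; rewrite !inE -bmods_sig; apply/eqP/cok_eqP => X g gh.
by have := gh l; rewrite !inE bmods_sig => /eqP.
Qed.
End Cokernel.

Section CokerMap.
Variables (L M L' M' : bmodsType).
Variables (h : {bmods L -> M}) (h' : {bmods L' -> M'}).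
Variables (l : {bmods L -> L'}) (u : {bmods M -> M'}).
Hypothesis lu : u \o h =1 h' \o l.

Lemma coker_map_kills : kills h (bcomp (cok h') u).
Proof.
move=> x; have /= e := lu x.
by have := cok_kills h' (l x); rewrite !inE /= e.
Qed.

Definition coker_map : {bmods Coker h -> Coker h'} :=
  coker_desc coker_map_kills.

Lemma coker_mapE b : coker_map (cok h b) = cok h' (u b).
Proof. exact: coker_descE. Qed.
End CokerMap.

(* Kernels and cokernels up to isomorphism, not only the canonical ones. *)
Definition is_kernel (L M N : bmodsType)
    (m : {bmods L -> M}) (q : {bmods M -> N}) : Prop :=
  exists2 phi : {bmods L -> Ker q}, is_iso phi & ker q \o phi =1 m.

Definition is_cokernel (L M N : bmodsType)
    (q : {bmods M -> N}) (m : {bmods L -> M}) : Prop :=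
  exists2 psi : {bmods Coker m -> N}, is_iso psi & psi \o cok m =1 q.

Record sdes := Sdes {
  sobj1 : bmodsType;
  sobj2 : bmodsType;
  sobj3 : bmodsType;
  smono : {bmods sobj1 -> sobj2};
  sepi : {bmods sobj2 -> sobj3};
  smono_kernel : is_kernel smono sepi;
  sepi_cokernel : is_cokernel sepi smono
}.

Record sdes_hom (c d : sdes) := SdesHom {
  shom1 : {bmods sobj1 c -> sobj1 d};
  shom2 : {bmods sobj2 c -> sobj2 d};
  shom3 : {bmods sobj3 c -> sobj3 d};
  shom_mono : shom2 \o smono c =1 smono d \o shom1;
  shom_epi : shom3 \o sepi c =1 sepi d \o shom2
}.

Record sdes_iso (c d : sdes) := SdesIso {
  siso_hom :> sdes_hom c d;
  siso_inv : sdes_hom d c;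
  siso1K : cancel (shom1 siso_hom) (shom1 siso_inv);
  siso1VK : cancel (shom1 siso_inv) (shom1 siso_hom);
  siso2K : cancel (shom2 siso_hom) (shom2 siso_inv);
  siso2VK : cancel (shom2 siso_inv) (shom2 siso_hom);
  siso3K : cancel (shom3 siso_hom) (shom3 siso_inv);
  siso3VK : cancel (shom3 siso_inv) (shom3 siso_hom)
}.

Definition finite_sdes (c : sdes) : Prop :=
  [/\ finite_set [set: sobj1 c], finite_set [set: sobj2 c] &
      finite_set [set: sobj3 c]].

Record functor := Functor {
  fobj :> bmodsType -> bmodsType;
  fmap : forall M N : bmodsType, {bmods M -> N} -> {bmods fobj M -> fobj N};
  fmap_id : forall M : bmodsType, fmap (bid M) = bid (fobj M);
  fmap_comp : forall (L M N : bmodsType)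
    (g : {bmods M -> N}) (f : {bmods L -> M}),
    fmap (bcomp g f) = bcomp (fmap g) (fmap f)
}.

Section InternalHom.
Variables (L M : bmodsType).

Definition Hom : Type := {bmods L -> M}.
HB.instance Definition _ := gen_eqMixin Hom.
HB.instance Definition _ := gen_choiceMixin Hom.

Section Operations.
Variables f g : {bmods L -> M}.
Lemma add_bmods_sig x : (f \+ g) (sig x) = sig ((f \+ g) x).
Proof. by rewrite /= !bmods_sig raddfD. Qed.
HB.instance Definition _ := isEquivariant.Build L M (f \+ g) add_bmods_sig.

Lemma null_bmods_sig x : (\0 : L -> M) (sig x) = sig ((\0 : L -> M) x).
Proof. by rewrite /= raddf0. Qed.
HB.instance Definition _ :=
  isEquivariant.Build L M (\0 : L -> M) null_bmods_sig.
End Operations.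

Definition Hom_add (f g : Hom) : Hom := ((f : L -> M) \+ g : {bmods L -> M}).
Definition Hom_zero : Hom := ((\0 : L -> M) : {bmods L -> M}).
Definition Hom_sig (f : Hom) : Hom := bcomp sig f.

Lemma Hom_addA : associative Hom_add.
Proof. by move=> f g k; apply/bmods_ext => x; exact: addrA. Qed.
Lemma Hom_addC : commutative Hom_add.
Proof. by move=> f g; apply/bmods_ext => x; exact: addrC. Qed.
Lemma Hom_add0 : left_id Hom_zero Hom_add.
Proof. by move=> f; apply/bmods_ext => x; exact: add0r. Qed.
HB.instance Definition _ :=
  GRing.isNmodule.Build Hom Hom_addA Hom_addC Hom_add0.

Lemma Hom_idem (f : Hom) : f + f = f.
Proof. by apply/bmods_ext => x; exact: addrr_idem. Qed.
HB.instance Definition _ := Nmodule_isIdempotent.Build Hom Hom_idem.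

Lemma Hom_sig_nmod_morphism : nmod_morphism Hom_sig.
Proof.
by split=> [|f g]; apply/bmods_ext => x; [exact: raddf0|exact: raddfD].
Qed.
Lemma Hom_sigK : involutive Hom_sig.
Proof. by move=> f; apply/bmods_ext => x; exact: sigK. Qed.
HB.instance Definition _ :=
  Bmodule_hasInvolution.Build Hom Hom_sig_nmod_morphism Hom_sigK.
End InternalHom.

Section HomFunctor.
Variable Q : bmodsType.

Section Map.
Variables (M N : bmodsType) (u : {bmods M -> N}).
Definition Hom_map_fun (f : Hom Q M) : Hom Q N := bcomp u f.
Lemma Hom_map_nmod_morphism : nmod_morphism Hom_map_fun.
Proof.
by split=> [|f g]; apply/bmods_ext => x; [exact: raddf0|exact: raddfD].
Qed.
HB.instance Definition _ := GRing.isNmodMorphism.Build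
  (Hom Q M) (Hom Q N) Hom_map_fun Hom_map_nmod_morphism.
Lemma Hom_map_sig f : Hom_map_fun (sig f) = sig (Hom_map_fun f).
Proof. by apply/bmods_ext => x; exact: bmods_sig. Qed.
HB.instance Definition _ :=
  isEquivariant.Build (Hom Q M) (Hom Q N) Hom_map_fun Hom_map_sig.
Definition Hom_map : {bmods Hom Q M -> Hom Q N} := Hom_map_fun.
End Map.

Lemma Hom_map_id (M : bmodsType) : Hom_map (bid M) = bid (Hom Q M).
Proof. by apply/bmods_ext => f; apply/bmods_ext. Qed.
Lemma Hom_map_comp (L M N : bmodsType)
    (g : {bmods M -> N}) (f : {bmods L -> M}) :
  Hom_map (bcomp g f) = bcomp (Hom_map g) (Hom_map f).
Proof. by apply/bmods_ext => k; apply/bmods_ext. Qed.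

Definition HomF : functor := Functor Hom_map_id Hom_map_comp.
End HomFunctor.

Section CokerFunctorial.
Variables (F : functor) (c d : sdes) (w : sdes_hom c d).

Lemma coker_fmap_subproof :
  fmap F (shom3 w) \o fmap F (sepi c) =1 fmap F (sepi d) \o fmap F (shom2 w).
Proof.
have e : bcomp (shom3 w) (sepi c) = bcomp (sepi d) (shom2 w).
  by apply/bmods_ext; exact: shom_epi.
move=> x; have := congr1 (fun k => (fmap F k : _ -> _) x) e.
by rewrite !fmap_comp.
Qed.

Definition coker_fmap :
  {bmods Coker (fmap F (sepi c)) -> Coker (fmap F (sepi d))} :=
  coker_map coker_fmap_subproof.
End CokerFunctorial.

Definition condition_a (F : functor) (a : sdes) : Prop :=
  forall (c : sdes) (v : {bmods sobj1 c -> sobj1 a}) (w1 w2 : sdes_hom c a),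
    shom1 w1 = v -> shom1 w2 = v -> coker_fmap F w1 = coker_fmap F w2.

(* A diagram is indexed by a graph: composition in the index category plays
   no role in the definition of a colimit. *)
Record diagram := Diagram {
  vertex : Type;
  edge : vertex -> vertex -> Type;
  dobj : vertex -> bmodsType;
  dmap : forall i j, edge i j -> {bmods dobj i -> dobj j}
}.

Arguments edge d i j : clear implicits.
Arguments dobj d i : clear implicits.

Record cocone (D : diagram) (X : bmodsType) := Cocone {
  leg :> forall i, {bmods dobj D i -> X};
  legE : forall i j (e : edge D i j), leg j \o dmap e =1 leg i
}.

Definition is_colimit (D : diagram) (X : bmodsType) (f : cocone D X) : Prop :=
  forall (Y : bmodsType) (g : cocone D Y),
    exists! u : {bmods X -> Y}, forall i, u \o f i =1 g i.

(* The colimit of D: formal finite sums of elements of the objects of D, two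
   of them being identified when they agree in every cocone under D. *)
Section Colimit.
Local Open Scope quotient_scope.
Variable D : diagram.

Let T : Type := {classic {i : vertex D & dobj D i}}.

Definition cocone_val (X : bmodsType) (f : cocone D X) (s : seq T) : X :=
  \sum_(t <- s) f (tag t) (tagged t).

Definition colim_rel : rel (seq T) := fun s s' =>
  `[< forall (X : bmodsType) (f : cocone D X),
        cocone_val f s = cocone_val f s' >].

Lemma colim_rel_equiv : equiv_class_of colim_rel.
Proof.
split=> [x|x y|y x z].
- exact/asboolP.
- by apply/asboolP/asboolP => xy X f; rewrite xy.
- by move=> /asboolP xy /asboolP yz; apply/asboolP => X f; rewrite xy yz.
Qed.
Canonical colim_equiv : equiv_rel (seq T) := EquivRelPack colim_rel_equiv.

Definition Colim : Type := {eq_quot colim_equiv}.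
HB.instance Definition _ := Choice.on Colim.
HB.instance Definition _ := EqQuotient.on Colim.

Lemma colim_eqP s s' : reflect
  (forall (X : bmodsType) (f : cocone D X), cocone_val f s = cocone_val f s')
  (\pi_Colim s == \pi_Colim s').
Proof. by rewrite piE; exact: asboolP. Qed.

Lemma colim_reprP (X : bmodsType) (f : cocone D X) s :
  cocone_val f (repr (\pi_Colim s)) = cocone_val f s.
Proof. by move: X f; apply/colim_eqP; rewrite reprK. Qed.

Definition tsig (t : T) : T := Tagged (dobj D) (sig (tagged t)).

Definition Colim_add (x y : Colim) : Colim := \pi_Colim (repr x ++ repr y).
Definition Colim_zero : Colim := \pi_Colim [::].
Definition Colim_sig (x : Colim) : Colim := \pi_Colim (map tsig (repr x)).

Lemma cocone_val_cat (X : bmodsType) (f : cocone D X) s s' :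
  cocone_val f (s ++ s') = cocone_val f s + cocone_val f s'.
Proof. exact: big_cat. Qed.

Lemma cocone_val_sig (X : bmodsType) (f : cocone D X) s :
  cocone_val f (map tsig s) = sig (cocone_val f s).
Proof.
rewrite /cocone_val big_map raddf_sum; apply: eq_bigr => t _.
exact: bmods_sig.
Qed.

Lemma Colim_addE s s' :
  Colim_add (\pi_Colim s) (\pi_Colim s') = \pi_Colim (s ++ s').
Proof.
by apply/eqP/colim_eqP => X f; rewrite !cocone_val_cat !colim_reprP.
Qed.

Lemma Colim_sigE s : Colim_sig (\pi_Colim s) = \pi_Colim (map tsig s).
Proof.
by apply/eqP/colim_eqP => X f; rewrite !cocone_val_sig colim_reprP.
Qed.

Lemma Colim_addA : associative Colim_add.
Proof.
move=> x y z; elim/quotW: x => x; elim/quotW: y => y; elim/quotW: z => z.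
rewrite (Colim_addE y z) (Colim_addE x y).
by rewrite (Colim_addE x (y ++ z)) (Colim_addE (x ++ y) z) catA.
Qed.
Lemma Colim_addC : commutative Colim_add.
Proof.
move=> x y; elim/quotW: x => x; elim/quotW: y => y.
rewrite (Colim_addE x y) (Colim_addE y x); apply/eqP/colim_eqP => X f.
by rewrite !cocone_val_cat addrC.
Qed.
Lemma Colim_add0 : left_id Colim_zero Colim_add.
Proof. by move=> x; elim/quotW: x => x; rewrite [LHS]Colim_addE. Qed.
HB.instance Definition _ :=
  GRing.isNmodule.Build Colim Colim_addA Colim_addC Colim_add0.

Lemma Colim_idem (x : Colim) : x + x = x.
Proof.
elim/quotW: x => x; rewrite [LHS]Colim_addE; apply/eqP/colim_eqP => X f.
by rewrite cocone_val_cat addrr_idem.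
Qed.
HB.instance Definition _ := Nmodule_isIdempotent.Build Colim Colim_idem.

Lemma Colim_sig_nmod_morphism : nmod_morphism Colim_sig.
Proof.
split=> [|x y]; first by rewrite Colim_sigE.
elim/quotW: x => x; elim/quotW: y => y.
by rewrite [X in Colim_sig X]Colim_addE !Colim_sigE [RHS]Colim_addE map_cat.
Qed.
Lemma Colim_sigK : involutive Colim_sig.
Proof.
move=> x; elim/quotW: x => x; rewrite (Colim_sigE x) Colim_sigE.
apply/eqP/colim_eqP => X f.
by rewrite !cocone_val_sig sigK.
Qed.
HB.instance Definition _ :=
  Bmodule_hasInvolution.Build Colim Colim_sig_nmod_morphism Colim_sigK.

Section Leg.
Variable i : vertex D.
Definition colim_leg_fun (a : dobj D i) : Colim :=
  \pi_Colim [:: Tagged (dobj D) a : T].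
Lemma colim_leg_nmod_morphism : nmod_morphism colim_leg_fun.
Proof.
split=> [|a b].
  apply/eqP/colim_eqP => X f.
  by rewrite /cocone_val big_seq1 big_nil /= raddf0.
rewrite [RHS]Colim_addE; apply/eqP/colim_eqP => X f.
by rewrite /cocone_val big_cat !big_seq1 /= raddfD.
Qed.
HB.instance Definition _ := GRing.isNmodMorphism.Build
  (dobj D i) Colim colim_leg_fun colim_leg_nmod_morphism.
Lemma colim_leg_sig a : colim_leg_fun (sig a) = sig (colim_leg_fun a).
Proof. by rewrite [RHS]Colim_sigE. Qed.
HB.instance Definition _ :=
  isEquivariant.Build (dobj D i) Colim colim_leg_fun colim_leg_sig.
Definition colim_leg : {bmods dobj D i -> Colim} := colim_leg_fun.
End Leg.

Lemma colim_legE i j (e : edge D i j) :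
  colim_leg j \o dmap e =1 colim_leg i.
Proof.
move=> a; apply/eqP/colim_eqP => X f.
by rewrite /cocone_val !big_seq1 /=; exact: legE.
Qed.
Definition colim_cocone : cocone D Colim := Cocone colim_legE.

Section Descent.
Variables (X : bmodsType) (f : cocone D X).

Definition colim_desc_fun (x : Colim) : X := cocone_val f (repr x).
Lemma colim_desc_funE s : colim_desc_fun (\pi_Colim s) = cocone_val f s.
Proof. exact: colim_reprP. Qed.

Lemma colim_desc_nmod_morphism : nmod_morphism colim_desc_fun.
Proof.
split=> [|x y]; first by rewrite colim_desc_funE /cocone_val big_nil.
elim/quotW: x => x; elim/quotW: y => y.
by rewrite [X in colim_desc_fun X]Colim_addE !colim_desc_funE cocone_val_cat.
Qed.
HB.instance Definition _ :=
  GRing.isNmodMorphism.Build Colim X colim_desc_fun colim_desc_nmod_morphism.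
Lemma colim_desc_sig x : colim_desc_fun (sig x) = sig (colim_desc_fun x).
Proof.
elim/quotW: x => x.
by rewrite [X in colim_desc_fun X]Colim_sigE !colim_desc_funE cocone_val_sig.
Qed.
HB.instance Definition _ :=
  isEquivariant.Build Colim X colim_desc_fun colim_desc_sig.
Definition colim_desc : {bmods Colim -> X} := colim_desc_fun.

Lemma colim_descE i : colim_desc \o colim_leg i =1 f i.
Proof.
by move=> a; rewrite /= [LHS]colim_desc_funE /cocone_val big_seq1.
Qed.
End Descent.

Lemma colim_ext (X : bmodsType) (u v : {bmods Colim -> X}) :
  (forall i, u \o colim_leg i =1 v \o colim_leg i) -> u = v.
Proof.
move=> uv; apply/bmods_ext; elim/quotW; elim=> [|[i a] s IHs].
  by rewrite -[\pi [::]]/(0 : Colim) !raddf0.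
rewrite -cat1s -Colim_addE.
rewrite -[Colim_add _ _]/(colim_leg i a + \pi_Colim s) !raddfD.
by congr (_ + _); [exact: uv | exact: IHs].
Qed.

Lemma colimP : is_colimit colim_cocone.
Proof.
move=> Y g; exists (colim_desc g); split=> [|u ug]; first exact: colim_descE.
by apply: colim_ext => i a; rewrite ug; exact: colim_descE.
Qed.
End Colimit.

(* The family Sh : I -> sdes spans the full subcategory Sh_small.  Its
   smallness is enforced by universe levels: the carrier of Colim contains the
   index set I, hence I is at most in the universe of the carriers of the
   objects of bmodsType, whereas sdes is in a strictly larger one. *)
Section Satellite.
Variables (F : functor) (I : Type) (Sh : I -> sdes).

Section Comma.
Variable X : bmodsType.

Definition comma : Type := {i : I & {bmods sobj1 (Sh i) -> X}}.

Definition comma_hom (p r : comma) : Type :=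
  {w : sdes_hom (Sh (tag p)) (Sh (tag r)) |
    tagged r \o shom1 w =1 tagged p}.

Definition satellite_diagram : diagram := @Diagram comma comma_hom
  (fun p => Coker (fmap F (sepi (Sh (tag p)))))
  (fun p r w => coker_fmap F (sval w)).

Definition satellite_obj : bmodsType := Colim satellite_diagram.

Definition satellite_leg (i : I) (x : {bmods sobj1 (Sh i) -> X}) :
    {bmods Coker (fmap F (sepi (Sh i))) -> satellite_obj} :=
  @colim_leg satellite_diagram (existT _ i x).
End Comma.

Section Map.
Variables (X Y : bmodsType) (u : {bmods X -> Y}).

Lemma satellite_map_subproof (p r : comma X) (w : comma_hom p r) :
  satellite_leg (bcomp u (tagged r)) \o coker_fmap F (sval w)
    =1 satellite_leg (bcomp u (tagged p)).
Proof.
case: w => w wE /= b.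
have uw : bcomp u (tagged r) \o shom1 w =1 bcomp u (tagged p).
  by move=> a /=; congr (u _); exact: wE.
exact: (@colim_legE (satellite_diagram Y)
  (existT _ (tag p) (bcomp u (tagged p)))
  (existT _ (tag r) (bcomp u (tagged r))) (exist _ w uw) b).
Qed.

Definition satellite_map : {bmods satellite_obj X -> satellite_obj Y} :=
  colim_desc (@Cocone (satellite_diagram X) _
    (fun p => satellite_leg (bcomp u (tagged p))) satellite_map_subproof).

Lemma satellite_mapE (i : I) (x : {bmods sobj1 (Sh i) -> X}) b :
  satellite_map (satellite_leg x b) = satellite_leg (bcomp u x) b.
Proof. exact: (@colim_descE (satellite_diagram X)). Qed.
End Map.

Lemma satellite_map_id X : satellite_map (bid X) = bid (satellite_obj X).
Proof.
apply: (@colim_ext (satellite_diagram X)) => -[i x] b.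
rewrite [LHS]satellite_mapE; congr (satellite_leg _ b).
exact/bmods_ext.
Qed.

Lemma satellite_map_comp (X Y Z : bmodsType)
    (v : {bmods Y -> Z}) (u : {bmods X -> Y}) :
  satellite_map (bcomp v u) = bcomp (satellite_map v) (satellite_map u).
Proof.
apply: (@colim_ext (satellite_diagram X)) => -[i x] b.
rewrite [LHS]satellite_mapE [RHS](congr1 _ (satellite_mapE _ _ _)).
rewrite satellite_mapE; congr (satellite_leg _ b).
exact/bmods_ext.
Qed.

Definition satellite : functor :=
  Functor satellite_map_id satellite_map_comp.

(* Sh_small contains a sequence c only up to isomorphism: the term indexed by
   (c, id) is that of (Sh i, phi^-1), transported along phi : c -> Sh i. *)
Definition satellite_can (c : sdes) (i : I) (phi : sdes_iso c (Sh i)) :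
    {bmods Coker (fmap F (sepi c)) -> satellite (sobj1 c)} :=
  bcomp (satellite_leg (shom1 (siso_inv phi))) (coker_fmap F phi).
End Satellite.

(* boolB is an alias because bool carries the addition of the field F_2. *)
Definition boolB : Type := bool.
HB.instance Definition _ := Finite.on boolB.
HB.instance Definition _ := GRing.isNmodule.Build boolB orbA orbC orFb.
HB.instance Definition _ := Nmodule_isIdempotent.Build boolB orbb.

Section Product.
Variables M N : bmodType.
Lemma pair_idem (x : M * N) : x + x = x.
Proof. by case: x => a b; congr pair; exact: addrr_idem. Qed.
HB.instance Definition _ := Nmodule_isIdempotent.Build (M * N)%type pair_idem.
End Product.

Section Swap.
Variable M : bmodType.
Definition swapsq : Type := (M * M)%type.
HB.instance Definition _ := Bmodule.on swapsq.

Definition swap (x : swapsq) : swapsq := (x.2, x.1).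
Lemma swap_nmod_morphism : nmod_morphism swap.
Proof. by []. Qed.
Lemma swapK : involutive swap.
Proof. by case. Qed.
HB.instance Definition _ :=
  Bmodule_hasInvolution.Build swapsq swap_nmod_morphism swapK.
End Swap.

Section SwapMap.
Variables (M N : bmodType) (f : {additive M -> N}).
Definition swapsq_map_fun (x : swapsq M) : swapsq N := (f x.1, f x.2).
Lemma swapsq_map_nmod_morphism : nmod_morphism swapsq_map_fun.
Proof.
by split=> [|x y]; rewrite /swapsq_map_fun /= ?raddf0 ?raddfD.
Qed.
HB.instance Definition _ := GRing.isNmodMorphism.Build
  (swapsq M) (swapsq N) swapsq_map_fun swapsq_map_nmod_morphism.
HB.instance Definition _ := isEquivariant.Build
  (swapsq M) (swapsq N) swapsq_map_fun (fun=> erefl).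
Definition swapsq_map : {bmods swapsq M -> swapsq N} := swapsq_map_fun.
End SwapMap.

Definition Delta_fun (x : boolB) : boolB * boolB := (x, x).
Lemma Delta_nmod_morphism : nmod_morphism Delta_fun.
Proof. by []. Qed.
HB.instance Definition _ := GRing.isNmodMorphism.Build
  boolB (boolB * boolB)%type Delta_fun Delta_nmod_morphism.
Definition Delta : {additive boolB -> boolB * boolB} := Delta_fun.

Definition sDelta : {bmods swapsq boolB -> swapsq (boolB * boolB)%type} :=
  swapsq_map Delta.

Section KerCok.
Variables (L M : bmodsType) (h : {bmods L -> M}).

Lemma ker_is_kernel (N : bmodsType) (q : {bmods M -> N}) :
  is_kernel (ker q) q.
Proof. by exists (bid _) => //; exists (bid _). Qed.

Lemma kills_ker_cok (X : bmodsType) (g : {bmods M -> X}) :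
  kills (ker (cok h)) g <-> kills h g.
Proof.
split=> [gk l|gh [b /= bK]].
  exact: (gk (Sub (h l) (cok_kills h l))).
move: bK; rewrite !inE -bmods_sig => /eqP/cok_eqP/(_ X g gh).
by rewrite bmods_sig => ->.
Qed.

Lemma cok_is_cokernel : is_cokernel (cok h) (ker (cok h)).
Proof.
have k1 : kills (ker (cok h)) (cok h) by apply/kills_ker_cok/cok_kills.
have k2 : kills h (cok (ker (cok h))) by apply/kills_ker_cok/cok_kills.
exists (coker_desc k1); last by move=> b; exact: coker_descE.
by exists (coker_desc k2); split=> x; have [b <-] := cok_surj x;
  rewrite !coker_descE.
Qed.

Definition ker_cok_sdes : sdes :=
  Sdes (ker_is_kernel (cok h)) cok_is_cokernel.
End KerCok.

Definition Q : bmodsType := Coker sDelta.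
Definition K : bmodsType := Ker (cok sDelta).
Definition F : functor := HomF Q.
Definition alpha : sdes := ker_cok_sdes sDelta.

(* Main.v *)
(* Q is generated by the classes q1, q2 of two elements e1, e2 freely generating
   s(B^2), subject to the single relation that q1 + q2 is fixed.  So a morphism
   f : Q -> X is a pair of elements of X whose sum is fixed.

   Condition (a): let f, f' : Q -> Q come from w1'', w2'' and lift their values
   at q1, q2 to s, t and s', t' in s(B^2).  As w1 = w2 on C', the elements
   s + t, s + sig s and t + sig t do not change under w1 -> w2.  The coordinates of
   (s, t) at which s + t is symmetric define a morphism g : Q -> s(B^2) below f,
   so f = f + cok g is identified with f + cok (sig g) in the cokernel; at the
   other coordinates s and t are determined by the invariants.

   SF(K): B is injective (extend the zero ideal of a character downwards), hence
   so is s(B^2), so every x : C' -> K extends to a morphism c -> alpha: the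
   object (alpha, id) is weakly terminal, and by condition (a) all morphisms to
   it induce the same map of cokernels.  These maps form a cocone, whose map
   out of the colimit is inverse to the leg at (alpha, id).

   Non-nullity: only 0 : Q -> s(B^2) has its image below id in End(Q), so the
   character of End(Q) vanishing exactly below id separates id from sig in the
   cokernel. *)
Require Import Defs.
From HB Require Import structures.
From mathcomp Require Import all_boot ssralg.
From mathcomp Require Import boolp classical_sets cardinality.

Set Implicit Arguments.
Unset Strict Implicit.
Unset Printing Implicit Defensive.

Import GRing.Theory.
Local Open Scope ring_scope.

(** * Cofree involutions *)

Section SwapLift.
Variables (M : bmodsType) (N : bmodType) (f : {additive M -> N}).

(** The transpose of [f]: [swapsq] is right adjoint to forgetting the involution. *)
Definition swap_lift_fun (x : M) : swapsq N := (f x, f (sig x)).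
Lemma swap_lift_nmod_morphism : nmod_morphism swap_lift_fun.
Proof. by split=> [|x y]; rewrite /swap_lift_fun ?raddf0 // !raddfD. Qed.
HB.instance Definition _ := GRing.isNmodMorphism.Build
  M (swapsq N) swap_lift_fun swap_lift_nmod_morphism.
Lemma swap_lift_sig x : swap_lift_fun (sig x) = sig (swap_lift_fun x).
Proof. by rewrite /swap_lift_fun sigK. Qed.
HB.instance Definition _ :=
  isEquivariant.Build M (swapsq N) swap_lift_fun swap_lift_sig.
Definition swap_lift : {bmods M -> swapsq N} := swap_lift_fun.
End SwapLift.

(** * Ideals, characters and injectivity of B *)

Section Ideal.
Variables (M : bmodType) (J : M -> Prop).
Hypotheses (J0 : J 0) (JD : forall x y, J (x + y) <-> J x /\ J y).

Definition off_ideal (x : M) : boolB := ~~ `[< J x >].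
Lemma off_ideal_nmod_morphism : nmod_morphism off_ideal.
Proof.
split=> [|x y]; rewrite /off_ideal; first by rewrite asboolT.
rewrite [RHS](_ : _ = ~~ `[< J x >] || ~~ `[< J y >]) // -negb_and -asbool_and.
by congr (~~ _); apply: asbool_equiv_eq.
Qed.
HB.instance Definition _ :=
  GRing.isNmodMorphism.Build M boolB off_ideal off_ideal_nmod_morphism.
Definition ideal_character : {additive M -> boolB} := off_ideal.
End Ideal.

Section PrincipalIdeal.
Variables (M : bmodType) (e : M).

Definition below (x : M) : Prop := x + e = e.
Lemma below0 : below 0. Proof. exact: add0r. Qed.
Lemma belowD x y : below (x + y) <-> below x /\ below y.
Proof.
split=> [xy|[xe ye]]; last by rewrite /below -addrA ye.
split; rewrite /below -[in LHS]xy !addrA ?addrr_idem //.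
by rewrite (addrC y) -(addrA x) addrr_idem.
Qed.

Definition not_below : {additive M -> boolB} := ideal_character below0 belowD.
Lemma not_belowP x : not_below x = false <-> below x.
Proof. by rewrite /= /off_ideal; split=> [/negbFE/asboolP|/asboolT ->]. Qed.
End PrincipalIdeal.

(** The ideal [J] pulls back along [m] to the zero ideal of [f]: by injectivity, [m l] below [m k]
    forces [l] below [k], so [f k = 0] gives [f l = 0]. *)
Lemma boolB_injective (L M : bmodType) (m : {additive L -> M})
    (f : {additive L -> boolB}) :
  injective m -> exists g : {additive M -> boolB}, g \o m =1 f.
Proof.
move=> m_inj.
pose J (x : M) := exists2 l, f l = 0 & below (m l) x.
have J0 : J 0 by exists 0; rewrite ?raddf0 //; exact: below0.
have JD x y : J (x + y) <-> J x /\ J y.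
  split=> [[l fl /belowD[xl yl]]|[[l fl xl] [k fk yk]]].
    by split; exists l.
  exists (l + k); first by rewrite raddfD fl fk.
  by rewrite /below raddfD addrACA xl yk.
exists (ideal_character J0 JD) => l /=; rewrite /off_ideal.
case fl : (f l).
  rewrite asboolF // => -[k fk]; rewrite /below -raddfD => /m_inj /(congr1 f).
  by rewrite raddfD fl fk.
by rewrite asboolT //; exists l; rewrite // /below addrr_idem.
Qed.

(** * Exactness in terms of elements *)

Section ShortDoublyExact.
Variable c : sdes.

Lemma smono_inj : injective (smono c).
Proof.
have [phi [psi [phiK _]] e] := smono_kernel c.
by move=> x y; rewrite -!e /= => /val_inj /(can_inj phiK).
Qed.

Lemma smonoP x : sig (sepi c x) = sepi c x -> exists l, smono c l = x.
Proof.
move=> fx; have [phi [psi [_ psiK]] e] := smono_kernel c.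
have kx : x \in inKer (sepi c) by rewrite !inE fx.
by exists (psi (Sub x kx)); rewrite -e /= psiK.
Qed.

Lemma sepi_surj y : exists x, sepi c x = y.
Proof.
have [psi [psi' [_ psiK]] e] := sepi_cokernel c.
have [x xE] := cok_surj (psi' y).
by exists x; rewrite -e /= xE psiK.
Qed.

Lemma sepi_factor (X : bmodsType) (u : {bmods sobj2 c -> X}) :
  kills (smono c) u -> exists v : {bmods sobj3 c -> X}, v \o sepi c =1 u.
Proof.
move=> ku; have [psi [psi' [psiK _]] e] := sepi_cokernel c.
exists (bcomp (coker_desc ku) psi') => x /=.
by rewrite -e /= psiK coker_descE.
Qed.
End ShortDoublyExact.

(** * Generators and relations for s(B^2) and Q *)

Notation sB2 := (swapsq (boolB * boolB)%type).
Definition e1 : sB2 := ((true, false), (false, false)).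
Definition e2 : sB2 := ((false, true), (false, false)).

Section Free.
Variables (X : bmodsType) (s t : X).

(** The Boolean coordinates are coerced to the natural multiples 0 and 1. *)
Definition sB2_map_fun (x : sB2) : X :=
  s *+ x.1.1 + t *+ x.1.2 + (sig s *+ x.2.1 + sig t *+ x.2.2).
Lemma sB2_map_nmod_morphism : nmod_morphism sB2_map_fun.
Proof.
have mulrD (x : X) (b c : boolB) : x *+ (b + c)%R = x *+ b + x *+ c.
  by case: b c => [] [] /=; rewrite ?addr0 ?add0r ?addrr_idem.
split=> [|x y]; first by rewrite /sB2_map_fun !addr0.
rewrite -[LHS]/(s *+ (x.1.1 + y.1.1)%R + t *+ (x.1.2 + y.1.2)%R
  + (sig s *+ (x.2.1 + y.2.1)%R + sig t *+ (x.2.2 + y.2.2)%R)) !mulrD.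
rewrite (addrACA (s *+ _)) (addrACA (sig s *+ _)).
exact: addrACA.
Qed.
HB.instance Definition _ := GRing.isNmodMorphism.Build
  sB2 X sB2_map_fun sB2_map_nmod_morphism.
Lemma sB2_map_sig x : sB2_map_fun (sig x) = sig (sB2_map_fun x).
Proof.
by rewrite /sB2_map_fun !raddfD /= !raddfMn /= !sigK addrC.
Qed.
HB.instance Definition _ :=
  isEquivariant.Build sB2 X sB2_map_fun sB2_map_sig.
Definition sB2_map : {bmods sB2 -> X} := sB2_map_fun.

Lemma sB2_map1 : sB2_map e1 = s.
Proof. by rewrite /sB2_map /= /sB2_map_fun /= !addr0. Qed.
Lemma sB2_map2 : sB2_map e2 = t.
Proof. by rewrite /sB2_map /= /sB2_map_fun /= !addr0 add0r. Qed.
End Free.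

Lemma sB2E x : x = sB2_map e1 e2 x.
Proof. by case: x => [[[] []] [[] []]]. Qed.

Lemma sB2_ext (X : bmodsType) (f g : {bmods sB2 -> X}) :
  f e1 = g e1 -> f e2 = g e2 -> f =1 g.
Proof.
move=> fg1 fg2 x; rewrite (sB2E x) /= /sB2_map_fun !raddfD /= !raddfMn /=.
by rewrite !bmods_sig fg1 fg2.
Qed.

(** [(true, false)] generates s(B) under addition and [sig], and [sDelta] sends it to [e1 + e2]. *)
Lemma sDelta_kills (X : bmodsType) (g : {bmods sB2 -> X}) :
  kills sDelta g <-> sig (g e1 + g e2) = g e1 + g e2.
Proof.
rewrite -raddfD; split=> [/(_ (true, false))|ge l].
  by rewrite !inE -!bmods_sig => /eqP.
rewrite !inE; apply/eqP; have ge' := ge; rewrite -bmods_sig in ge'.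
case: l => [[] []]; rewrite -bmods_sig //.
Qed.

Definition q1 : Q := cok sDelta e1.
Definition q2 : Q := cok sDelta e2.

Lemma q12_sig : sig (q1 + q2) = q1 + q2.
Proof. by apply/sDelta_kills/cok_kills. Qed.

Lemma Q_ext (X : bmodsType) (f g : {bmods Q -> X}) :
  f q1 = g q1 -> f q2 = g q2 -> f = g.
Proof.
move=> fg1 fg2; apply: bmods_ext => x; have [y <-] := cok_surj x.
exact: (@sB2_ext _ (bcomp f (cok sDelta)) (bcomp g (cok sDelta))).
Qed.

Lemma Q_map (X : bmodsType) (s t : X) : sig (s + t) = s + t ->
  exists2 f : {bmods Q -> X}, f q1 = s & f q2 = t.
Proof.
move=> st.
have k : kills sDelta (sB2_map s t).
  by apply/sDelta_kills; rewrite sB2_map1 sB2_map2.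
by exists (coker_desc k); rewrite coker_descE ?sB2_map1 ?sB2_map2.
Qed.

(** * Symmetrization and condition (a) *)

Definition symmetric_part (k s : sB2) : sB2 :=
  ((((k.1.1 == k.2.1) && s.1.1 : boolB), ((k.1.2 == k.2.2) && s.1.2 : boolB)),
   (((k.1.1 == k.2.1) && s.2.1 : boolB), ((k.1.2 == k.2.2) && s.2.2 : boolB))).

Lemma symmetric_part_le k s : s + symmetric_part k s = s.
Proof.
have absorb (b x : bool) : x || b && x = x by case: b x => [] [].
by case: s => [[s11 s12] [s21 s22]]; congr ((_, _), (_, _)); exact: absorb.
Qed.

Lemma symmetric_partD k s t :
  symmetric_part k s + symmetric_part k t = symmetric_part k (s + t).
Proof.
case: k s t => [[k11 k12] [k21 k22]] [[s11 s12] [s21 s22]].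
case=> [[t11 t12] [t21 t22]].
by congr ((_, _), (_, _)); exact/esym/andb_orr.
Qed.

Lemma symmetric_part_sig k : sig (symmetric_part k k) = symmetric_part k k.
Proof. by case: k => [[[] []] [[] []]]. Qed.

(** Where [k] is symmetric, the left side is a coordinate of [s + sig s]. Elsewhere one entry of [k]
    vanishes, so that entry of [s] does too, and [s + sig s] gives the other. *)
Lemma symmetric_part_inv k s t : s + k = k -> t + k = k ->
  s + sig s = t + sig t ->
  s + sig (symmetric_part k s) = t + sig (symmetric_part k t).
Proof.
have coord (c c' x x' y y' : bool) : x || c = c -> x' || c' = c' ->
    y || c = c -> y' || c' = c' -> x || x' = y || y' ->
    x || (c == c') && x' = y || (c == c') && y'.
  by case: c c' x x' y y' => [] [] [] [] [] [].
case: k s t => [[k11 k12] [k21 k22]] [[s11 s12] [s21 s22]].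
case=> [[t11 t12] [t21 t22]].
move=> [ks11 ks12 ks21 ks22] [kt11 kt12 kt21 kt22] [e1 e2 e3 e4].
by congr ((_, _), (_, _)) => /=; [ | | rewrite eq_sym | rewrite eq_sym];
  exact: coord.
Qed.

(** [f] absorbs [h g], whose class in the cokernel is fixed by [sig]. *)
Lemma cok_absorb (L X : bmodsType) (h : {bmods L -> X})
    (f : X) (g : L) : f + h g = f -> cok h f = cok h (f + sig (h g)).
Proof.
move=> fg; have := cok_kills h g; rewrite !inE -bmods_sig => /eqP hg.
by rewrite raddfD /= bmods_sig -bmods_sig hg -raddfD fg.
Qed.

Lemma coker_HomQ_symmetrize (f : Hom Q Q) (s t : sB2) :
  f q1 = cok sDelta s -> f q2 = cok sDelta t ->
  exists f' : Hom Q Q,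
    [/\ cok (fmap F (cok sDelta)) f = cok (fmap F (cok sDelta)) f',
     f' q1 = cok sDelta (s + sig (symmetric_part (s + t) s)) &
     f' q2 = cok sDelta (t + sig (symmetric_part (s + t) t))].
Proof.
move=> f1 f2.
(* The two values add up to the symmetric part of [s + t] itself, which is fixed, as [Q_map]
   requires. *)
have [|g g1 g2] :=
    @Q_map _ (symmetric_part (s + t) s) (symmetric_part (s + t) t).
  by rewrite symmetric_partD symmetric_part_sig.
exists (f + sig (fmap F (cok sDelta) g)); split.
- apply: cok_absorb; apply: (@Q_ext Q); rewrite /= ?f1 ?f2 ?g1 ?g2 -raddfD.
    by rewrite symmetric_part_le.
  by rewrite symmetric_part_le.
- by rewrite [LHS]/(f q1 + sig (cok sDelta (g q1))) f1 g1 raddfD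
    [X in _ = _ + X]bmods_sig.
- by rewrite [LHS]/(f q2 + sig (cok sDelta (g q2))) f2 g2 raddfD
    [X in _ = _ + X]bmods_sig.
Qed.

Lemma coker_HomQ_eq (f f' : Hom Q Q) (s t s' t' : sB2) :
  f q1 = cok sDelta s -> f q2 = cok sDelta t ->
  f' q1 = cok sDelta s' -> f' q2 = cok sDelta t' ->
  s + t = s' + t' -> s + sig s = s' + sig s' -> t + sig t = t' + sig t' ->
  cok (fmap F (cok sDelta)) f = cok (fmap F (cok sDelta)) f'.
Proof.
move=> f1 f2 f'1 f'2 st ss tt.
have [g [-> g1 g2]] := coker_HomQ_symmetrize f1 f2.
have [g' [-> g'1 g'2]] := coker_HomQ_symmetrize f'1 f'2.
have absorb (x y : sB2) : x + (x + y) = x + y by rewrite addrA addrr_idem.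
congr (cok _ _); apply: (@Q_ext Q); rewrite ?g1 ?g2 ?g'1 ?g'2 -st;
  congr (cok _ _); apply: symmetric_part_inv; rewrite ?absorb //.
- by rewrite st absorb.
- by rewrite addrC -addrA addrr_idem.
- by rewrite st addrC -addrA addrr_idem.
Qed.

(** An element with fixed image comes from the first term, where [w1] and [w2] agree. *)
Lemma shom2_eq (c d : sdes) (w1 w2 : sdes_hom c d) y :
  shom1 w1 =1 shom1 w2 -> sig (sepi c y) = sepi c y -> shom2 w1 y = shom2 w2 y.
Proof.
move=> w12 /smonoP[x <-].
by rewrite [LHS](shom_mono w1) [RHS](shom_mono w2) /= w12.
Qed.

Lemma condition_a_alpha : condition_a F alpha.
Proof.
move=> c v w1 w2 w1v w2v; have w12 : shom1 w1 =1 shom1 w2 by rewrite w1v w2v.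
apply: bmods_ext => z; have [phi <-] := cok_surj z.
rewrite !coker_mapE.
(* [y1 + y2] has fixed image by the relation in Q, and [y + sig y] has one for every [y]; [shom2_eq]
   thus applies to all three invariants. *)
have [y1 y1E] := sepi_surj (phi q1); have [y2 y2E] := sepi_surj (phi q2).
have fixD y : sig (sepi c (y + sig y)) = sepi c (y + sig y).
  by rewrite -bmods_sig (raddfD sig) /= sigK addrC.
apply: (@coker_HomQ_eq _ _ (shom2 w1 y1) (shom2 w1 y2)
  (shom2 w2 y1) (shom2 w2 y2)).
- by rewrite -[LHS]/(shom3 w1 (phi q1)) -y1E; exact: (shom_epi w1 y1).
- by rewrite -[LHS]/(shom3 w1 (phi q2)) -y2E; exact: (shom_epi w1 y2).
- by rewrite -[LHS]/(shom3 w2 (phi q1)) -y1E; exact: (shom_epi w2 y1).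
- by rewrite -[LHS]/(shom3 w2 (phi q2)) -y2E; exact: (shom_epi w2 y2).
- rewrite -!raddfD; apply: (shom2_eq w12).
  by rewrite (raddfD (sepi c)) /= y1E y2E -(raddfD phi) -bmods_sig q12_sig.
- by rewrite -!bmods_sig -!raddfD; exact: (shom2_eq w12).
- by rewrite -!bmods_sig -!raddfD; exact: (shom2_eq w12).
Qed.

(** * Weak terminality of [alpha] *)

(** By adjunction [f] amounts to its first component, a pair of characters; each extends along
    [m]. *)
Lemma sB2_injective (L M : bmodsType) (m : {bmods L -> M})
    (f : {bmods L -> sB2}) :
  injective m -> exists g : {bmods M -> sB2}, g \o m =1 f.
Proof.
move=> m_inj.
have f1_morph : nmod_morphism (fun l => (f l).1.1 : boolB).
  by split=> [|x y]; rewrite ?raddf0 ?raddfD.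
have f2_morph : nmod_morphism (fun l => (f l).1.2 : boolB).
  by split=> [|x y]; rewrite ?raddf0 ?raddfD.
pose f1 : {additive L -> boolB} := HB.pack (fun l => (f l).1.1 : boolB)
  (GRing.isNmodMorphism.Build _ _ _ f1_morph).
pose f2 : {additive L -> boolB} := HB.pack (fun l => (f l).1.2 : boolB)
  (GRing.isNmodMorphism.Build _ _ _ f2_morph).
have [g1 g1E] := boolB_injective f1 m_inj.
have [g2 g2E] := boolB_injective f2 m_inj.
have g_morph : nmod_morphism (fun x => (g1 x, g2 x)).
  by split=> [|x y]; rewrite ?raddf0 // !raddfD.
pose g : {additive M -> boolB * boolB} := HB.pack (fun x => (g1 x, g2 x))
  (GRing.isNmodMorphism.Build _ _ _ g_morph).
exists (swap_lift g) => l /=.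
rewrite /swap_lift_fun -bmods_sig /= ![g1 _]g1E ![g2 _]g2E /= bmods_sig.
by case: (f l) => [[? ?] [? ?]].
Qed.

Lemma alpha_weakly_terminal (c : sdes) (x : {bmods sobj1 c -> K}) :
  exists w : sdes_hom c alpha, shom1 w = x.
Proof.
have [u uE] := sB2_injective (bcomp (ker (cok sDelta)) x) (@smono_inj c).
have [|v vE] := @sepi_factor c Q (bcomp (cok sDelta) u).
  by move=> l; rewrite !inE /= [u _]uE; exact: (valP (x l)).
by exists (@SdesHom c alpha x u v uE vE).
Qed.

(** * The satellite at a weakly terminal sequence *)

Definition sdes_comp (c d e : sdes) (v : sdes_hom d e) (w : sdes_hom c d) :
  sdes_hom c e.
Proof.
refine (@SdesHom c e (bcomp (shom1 v) (shom1 w)) (bcomp (shom2 v) (shom2 w))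
  (bcomp (shom3 v) (shom3 w)) _ _) => x /=.
  rewrite [shom2 w _](shom_mono w); exact: (shom_mono v).
rewrite [shom3 w _](shom_epi w); exact: (shom_epi v).
Defined.

Lemma coker_fmapE (G : functor) (c d : sdes) (w : sdes_hom c d) y :
  coker_fmap G w (cok (fmap G (sepi c)) y) =
  cok (fmap G (sepi d)) (fmap G (shom3 w) y).
Proof. exact: coker_mapE. Qed.

Lemma coker_fmap_comp (G : functor) (c d e : sdes) (v : sdes_hom d e)
    (w : sdes_hom c d) z :
  coker_fmap G (sdes_comp v w) z = coker_fmap G v (coker_fmap G w z).
Proof.
have [y <-] := cok_surj z.
rewrite !coker_fmapE.
congr (cok _ _).
exact: (congr1 (fun k : {bmods _ -> _} => k y) (fmap_comp G _ _)).
Qed.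

Definition sdes_id (c : sdes) : sdes_hom c c :=
  @SdesHom c c (bid _) (bid _) (bid _) (fun=> erefl) (fun=> erefl).

Lemma coker_fmap_id (G : functor) (c : sdes) : coker_fmap G (sdes_id c) =1 id.
Proof.
by move=> z; have [y <-] := cok_surj z; rewrite coker_fmapE fmap_id.
Qed.

Lemma satellite_can_is_iso (G : functor) (a : sdes) (I : Type) (Sh : I -> sdes)
    (i : I) (phi : sdes_iso a (Sh i)) :
  condition_a G a ->
  (forall (c : sdes) (x : {bmods sobj1 c -> sobj1 a}),
     exists w : sdes_hom c a, shom1 w = x) ->
  is_iso (satellite_can G phi).
Proof.
move=> cond ext.
pose W (p : comma Sh (sobj1 a)) := sval (cid (ext _ (tagged p))).
have WE p : shom1 (W p) = tagged p := svalP (cid (ext _ (tagged p))).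
pose lg (p : vertex (satellite_diagram G Sh (sobj1 a))) :
  {bmods dobj _ p -> Coker (fmap G (sepi a))} := coker_fmap G (W p).
have lgE p r (e : edge _ p r) : lg r \o dmap e =1 lg p.
  case: e => w wE z.
  rewrite -[LHS]/(coker_fmap G (W r) (coker_fmap G w z)) -coker_fmap_comp.
  (* [W r] after [w] and [W p] induce the same map, so condition (a) makes the arbitrary choices
     compatible. *)
  congr ((_ : {bmods _ -> _}) z); apply: (cond _ (tagged p)); rewrite ?WE //.
  by apply: bmods_ext => y /=; rewrite WE; exact: wE.
pose p0 : comma Sh (sobj1 a) := existT _ i (shom1 (siso_inv phi)).
exists (colim_desc (Cocone lgE)); split.
  move=> z; rewrite [LHS](@colim_descE (satellite_diagram G Sh (sobj1 a))).
  rewrite -[LHS]/(coker_fmap G (W p0) (coker_fmap G phi z)) -coker_fmap_comp.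
  rewrite -[RHS](@coker_fmap_id G a).
  (* [W p0] after [phi] induces the identity, as [sdes_id a] does. *)
  congr ((_ : {bmods _ -> _}) z); apply: (cond _ (bid _)) => //.
  by apply: bmods_ext => y /=; rewrite WE; exact: siso1K.
set u := colim_desc _.
suff uK : bcomp (satellite_can G phi) u = bid (satellite G Sh (sobj1 a)).
  by move=> z; exact: (congr1 (fun k : {bmods _ -> _} => k z) uK).
apply: (@colim_ext (satellite_diagram G Sh (sobj1 a))) => p y.
rewrite -[LHS]/(satellite_can G phi (u _)).
rewrite [u _](@colim_descE (satellite_diagram G Sh (sobj1 a))).
rewrite -[LHS]/(satellite_leg _ _ (coker_fmap G phi (coker_fmap G (W p) y))).
rewrite -coker_fmap_comp.
(* [phi] after [W p] is thus an edge from [p] to [p0], which identifies the two legs. *)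
have e : tagged p0 \o shom1 (sdes_comp phi (W p)) =1 tagged p.
  by move=> t /=; rewrite siso1K WE.
exact: (@colim_legE (satellite_diagram G Sh (sobj1 a)) p p0
  (exist _ (sdes_comp phi (W p)) e) y).
Qed.

(** * Finiteness of [alpha] and non-nullity *)

Lemma alpha_finite : finite_sdes alpha.
Proof.
have finM : finite_set [set: sB2].
  exact: (@finite_finset (boolB * boolB * (boolB * boolB))%type).
split=> //.
  apply: (@sub_finite_set _ _ ((val : K -> sB2) @^-1` [set: sB2])) => //.
  by apply: finite_preimage => // x y _ _; exact: val_inj.
apply: (sub_finite_set _ (finite_image (cok sDelta) finM)) => x _.
by have [y <-] := cok_surj x; exists y.
Qed.

(** Both hypotheses make the lift of [not_below e] send [e1 + e2] to a fixed pair, so it descends to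
    Q and detects the order there. *)
Lemma cok_below (e x : sB2) :
  ~ below e (e1 + e2) -> ~ below e (sig (e1 + e2)) ->
  below (cok sDelta e) (cok sDelta x) -> below e x.
Proof.
move=> ne ne'.
have ne_true y : ~ below e y -> not_below e y = true.
  by case ey: (not_below e y) => // /not_belowP.
have k : kills sDelta (swap_lift (not_below e)).
  apply/sDelta_kills; rewrite -raddfD /= /swap_lift_fun.
  rewrite -[LHS]/(not_below e (sig (e1 + e2)),
                  not_below e (sig (sig (e1 + e2)))).
  by rewrite sigK !ne_true.
rewrite {1}/below -raddfD => /cok_eqP/(_ _ _ k)[xe _].
have /not_belowP ee : below e e by exact: addrr_idem.
by have /not_belowP/belowD[] := etrans xe ee.
Qed.

Lemma Hom_below_id_eq0 (l : Hom Q sB2) :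
  below (bid Q : Hom Q Q) (fmap F (cok sDelta) l) -> l = 0.
Proof.
move=> lid; have lq q : below q (cok sDelta (l q)).
  exact: (congr1 (fun k : {bmods Q -> Q} => k q) lid).
have l1 : below e1 (l q1) by apply: cok_below (lq q1).
have l2 : below e2 (l q2) by apply: cok_below (lq q2).
have l12 : sig (l q1 + l q2) = l q1 + l q2.
  by rewrite -(raddfD l) -bmods_sig q12_sig.
(* Each [l q] is now 0 or the matching generator, and no nonzero sum of [e1], [e2] is fixed. *)
apply: Q_ext.
  by case: (l q1) (l q2) l1 l2 l12 => [[[] []] [[] []]] [[[] []] [[] []]].
by case: (l q1) (l q2) l1 l2 l12 => [[[] []] [[] []]] [[[] []] [[] []]].
Qed.

Lemma coker_HomQ_non_null : ~ null (Coker (fmap F (cok sDelta))).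
Proof.
move=> cnull; pose one : Hom Q Q := bid Q.
have k : kills (fmap F (cok sDelta)) (swap_lift (not_below one)).
  (* On the range the character only tests [l != 0], a [sig]-invariant condition; hence its lift
     kills the range. *)
  have nb l : not_below one (fmap F (cok sDelta) l) = (l != 0).
    case: eqVneq => [->|/eqP l0]; first by rewrite !raddf0.
    by case e: (not_below one _) => //; move/not_belowP/Hom_below_id_eq0: e.
  have sig0 l : (sig l != 0 :> Hom Q sB2) = (l != 0).
    by rewrite -{1}(raddf0 sig) (can_eq sigK).
  move=> l; rewrite !inE /= -bmods_sig /= /swap_lift_fun -!bmods_sig.
  by rewrite !nb !sig0.
have := cnull (cok (fmap F (cok sDelta)) one).
rewrite -bmods_sig => /cok_eqP/(_ _ _ k)[].
have /not_belowP -> : below one one by exact: addrr_idem.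
(* Nullity would put [sig] below the identity, hence [sig e1] below [e1], which is absurd. *)
move=> /not_belowP/(congr1 (fun k : {bmods Q -> Q} => k q1)) sq1.
have : below e1 (sig e1); last by [].
by apply: cok_below => //; rewrite /below bmods_sig; exact: sq1.
Qed.

Lemma is_iso_null (X Y : bmodsType) (f : {bmods X -> Y}) :
  is_iso f -> null Y -> null X.
Proof.
case=> g [fK _] nY x; apply: (can_inj fK).
by rewrite bmods_sig nY.
Qed.

Theorem theorem1p12 (I : Type) (Sh : I -> sdes)
    (Sh_finite : forall c : sdes, finite_sdes c ->
       exists i : I, inhabited (sdes_iso c (Sh i))) :
  [/\ condition_a F alpha,
      exists X : bmodsType, ~ null (satellite F Sh X),
      exists i : I, inhabited (sdes_iso alpha (Sh i)) &
      forall (i : I) (phi : sdes_iso alpha (Sh i)),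
        is_iso (satellite_can F phi
                : {bmods Coker (fmap F (cok sDelta)) -> satellite F Sh K})].
Proof.
have iso i (phi : sdes_iso alpha (Sh i)) : is_iso (satellite_can F phi).
  exact: satellite_can_is_iso condition_a_alpha alpha_weakly_terminal.
have [i [phi]] := Sh_finite _ alpha_finite.
split.
- exact: condition_a_alpha.
- exists K => nSF; apply: coker_HomQ_non_null.
  exact: is_iso_null (iso i phi) nSF.
- by exists i; split.
- exact: iso.
Qed.
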